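(* Let $n\geqslant 2$ be an integer. If $f(N_{\omega(n)})-e^{\gamma}\log\log N_{\omega(n)}\leqslant 0$, then $n$ satisfies Robin's inequality $s(n)<e^{\gamma}\log\log n$.
   Context: $\omega(n)$ is the number of distinct primes dividing $n$; $\sigma(n)=\sum_{d\mid n} d$; $s(n)=\sigma(n)/n$; $f(n)=n/\varphi(n)$ with $\varphi$ Euler's totient; $p_i$ is the $i$-th prime; $N_k=\prod_{j\leqslant k}p_j$ is the $k$-th primorial; $\gamma$ is Euler's constant. *)

(* Defs.v *)
From mathcomp Require Import all_boot all_order all_algebra.
From mathcomp Require Import all_classical all_reals all_analysis.
Import Order.TTheory GRing.Theory Num.Theory.
Import numFieldNormedType.Exports.

Set Implicit Arguments.
Unset Strict Implicit.
Unset Printing Implicit Defensive.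

Local Open Scope ring_scope.
Local Open Scope classical_set_scope.

Definition omega (n : nat) : nat := size (primes n).

Definition sigma (n : nat) : nat := (\sum_(d <- divisors n) d)%N.

Lemma ex_prime_above (m : nat) : exists p, (m < p)%N && prime p.
Proof. by have [p mp pp] := prime_above m; exists p; rewrite mp pp. Qed.

Definition next_prime (m : nat) : nat := ex_minn (ex_prime_above m).

(* The enumeration starts at index 1: nth_prime 1 = 2, nth_prime 2 = 3, and
   so on; nth_prime 0 = 0 is only a seed for the iteration. *)
Definition nth_prime (i : nat) : nat := iter i next_prime 0%N.

Definition primorial (k : nat) : nat := (\prod_(1 <= j < k.+1) nth_prime j)%N.

Definition s_ratio (R : realType) (n : nat) : R := (sigma n)%:R / n%:R.

Definition f_ratio (R : realType) (n : nat) : R := n%:R / (totient n)%:R.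

(* [series harmonic n] is 1 + 1/2 + ... + 1/n. *)
Definition euler_gamma_seq (R : realType) : R^nat :=
  fun n => series harmonic n - ln n%:R.

Definition euler_gamma (R : realType) : R := lim (euler_gamma_seq R @ \oo).

(* [lim] is a junk value on divergent sequences; this one converges. *)
Lemma is_cvg_euler_gamma_seq (R : realType) : cvgn (euler_gamma_seq R).
Proof.
have lnS n : ln n.+2%:R = ln n.+1%:R + ln (1 + n.+1%:R^-1) :> R.
  rewrite -lnM ?posrE ?ltr0n ?addr_gt0 ?invr_gt0 ?ltr0n //.
  by rewrite mulrDr mulr1 divff ?pnatr_eq0// -natr1.
have lnSV n : ln n.+1%:R = ln n.+2%:R + ln (1 - n.+2%:R^-1) :> R.
  have h : 0 < 1 - n.+2%:R^-1 :> R by rewrite subr_gt0 invf_lt1 ?ltr0n ?ltr1n.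
  rewrite -lnM ?posrE ?ltr0n //.
  by rewrite mulrBr mulr1 divff ?pnatr_eq0// -[n.+2%:R]natr1 addrK.
have serS n : series harmonic n.+1 = series harmonic n + n.+1%:R^-1 :> R.
  by rewrite /series /= big_nat_recr.
suff : cvgn (fun n => euler_gamma_seq R n.+1).
  by move/cvg_ex => [l hl]; apply/cvg_ex; exists l; rewrite -cvg_shiftS.
apply: nonincreasing_is_cvgn.
  apply/nonincreasing_seqP => n; rewrite /euler_gamma_seq (serS n.+1).
  rewrite (lnSV n).
  have : ln (1 + - n.+2%:R^-1) <= - n.+2%:R^-1 :> R.
    by apply: le_ln1Dx; rewrite ltrN2 invf_lt1 ?ltr0n ?ltr1n.
  by move=> h; rewrite opprD [leLHS]addrAC [leRHS]addrA lerD2l lerNr.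
exists 0 => _ [n _ <-]; rewrite /euler_gamma_seq subr_ge0.
have : ln n.+2%:R <= series harmonic n.+1 :> R.
  elim: n => [|n IH].
    rewrite lnS ln1 add0r serS [series _ _]big_geq // add0r.
    by apply: le_ln1Dx; rewrite (lt_le_trans (ltrN10 R)) ?invr_ge0 ?ler0n.
  rewrite lnS serS lerD //.
  by apply: le_ln1Dx; rewrite (lt_le_trans (ltrN10 R)) ?invr_ge0 ?ler0n.
by apply: le_trans; rewrite ler_ln ?posrE ?ltr0n // ler_nat.
Qed.

(* Main.v *)
Require Import Defs.
From mathcomp Require Import all_boot all_order all_algebra cyclic.
From mathcomp Require Import all_classical all_reals all_analysis.
Import Order.TTheory GRing.Theory Num.Theory.
Local Open Scope ring_scope.

(** The bound [sigma n * totient n < n ^ 2] gives [s n < f n]. Next,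
    [f n] is the product of [p / (p - 1)] over the primes [p] dividing [n], and
    the [i]-th smallest of them is at least the [i]-th prime, so
    [f n <= f N] and [N <= n] for the primorial [N] of index [omega n].
    Monotonicity of [log log] concludes. *)

(* An interval of length [a * b] consists of [a] periods of [coprime b]. *)
Lemma totient_mul_le (a b : nat) : (totient (a * b) <= a * totient b)%N.
Proof.
suff <- : (\sum_(0 <= d < a * b) coprime b d = a * totient b)%N.
  rewrite totient_count_coprime; apply: leq_sum => d _.
  by rewrite coprimeMl; case: (coprime a d).
elim: a => [|a IH]; first by rewrite !mul0n big_geq.
rewrite !mulSnr (big_cat_nat (n := (a * b)%N)) ?leq_addr //= IH; congr (_ + _)%N.
rewrite totient_count_coprime -{1}[(a * b)%N]add0n big_addn addKn.
by apply: eq_bigr => d _; rewrite addnC -coprime_modr modnMDl coprime_modr.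
Qed.

(** The residue 0 is not coprime to [n], since [gcdn n 0 = n] is not 1. *)
Lemma totient_lt (n : nat) : (1 < n)%N -> (totient n < n)%N.
Proof.
case: n => [|n] n1 //; rewrite totient_count_coprime big_nat_recl //.
rewrite /coprime gcdn0 gtn_eqF // add0n ltnS.
apply: (@leq_trans (\sum_(0 <= i < n) 1)%N); first by apply: leq_sum => i _; exact: leq_b1.
by rewrite sum_nat_const_nat subn0 muln1.
Qed.

(** Puts [sigma] in the index form of [sum_totient_dvd], so that the two sums can be compared term
    by term. *)
Lemma sigmaE (n : nat) : (0 < n)%N -> sigma n = (\sum_(d < n.+1 | d %| n) d)%N.
Proof.
move=> n0; rewrite /sigma -(big_mkord (fun d => (d %| n)%N) id) -[RHS]big_filter.
apply: perm_big; apply: uniq_perm.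
- exact: divisors_uniq.
- by rewrite filter_uniq ?iota_uniq.
- move=> d; rewrite -dvdn_divisors // mem_filter mem_index_iota ltnS.
  by case: (boolP (d %| n)%N) => // /(dvdn_leq n0) ->.
Qed.

(* For [d %| n], [d * totient n <= d * (n %/ d) * totient d = n * totient d],
   strictly for [d = 1]; now sum over [d], the totients adding up to [n]. *)
Lemma sigma_totient_lt (n : nat) : (1 < n)%N -> (sigma n * totient n < n * n)%N.
Proof.
move=> n1; have n0 : (0 < n)%N := ltnW n1.
rewrite sigmaE // -[X in (_ < _ * X)%N]sum_totient_dvd big_distrl big_distrr /=.
have h1 : (1 < n.+1)%N by [].
rewrite (bigD1 (Ordinal h1)) ?dvd1n //= [ltnRHS](bigD1 (Ordinal h1)) ?dvd1n //=.
rewrite -addSn; apply: leq_add; first by rewrite mul1n muln1 totient_lt.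
apply: leq_sum => d /andP[dn _].
have := totient_mul_le (n %/ d) d; rewrite divnK // => h.
by rewrite -[X in (_ <= X * _)%N](divnK dn) mulnAC mulnC leq_mul2r h orbT.
Qed.

Lemma s_ratio_lt_f_ratio (R : realType) (n : nat) :
  (1 < n)%N -> s_ratio R n < f_ratio R n.
Proof.
move=> n1; have n0 : (0 < n)%N := ltnW n1.
rewrite /s_ratio /f_ratio ltr_pdivrMr ?ltr0n // mulrAC ltr_pdivlMr ?ltr0n ?totient_gt0 //.
by rewrite -!natrM ltr_nat sigma_totient_lt.
Qed.

(** One factor [p] is split off each prime power to match the shape of [totientE]; the powers
    [p ^ (logn p n).-1] then cancel in [f_ratio]. *)
Lemma prod_primesE (n : nat) :
  (0 < n)%N -> n = (\prod_(p <- primes n) (p * p ^ (logn p n).-1))%N.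
Proof.
move=> n0; rewrite [LHS](prod_prime_decomp n0) prime_decompE big_map.
apply: eq_big_seq => p; rewrite -logn_gt0 => e0 /=.
by rewrite -expnS prednK.
Qed.

Lemma f_ratioE (R : realType) (n : nat) : (0 < n)%N ->
  f_ratio R n = \prod_(p <- primes n) (p%:R / p.-1%:R).
Proof.
move=> n0; rewrite /f_ratio totientE // [X in X%:R / _](prod_primesE n n0).
rewrite !natr_prod -prodf_div; apply: eq_big_seq => p.
rewrite mem_primes => /and3P[pp _ _].
rewrite !natrM -mulf_div divff ?mulr1 // pnatr_eq0 -lt0n expn_gt0.
by rewrite prime_gt0.
Qed.

Lemma next_primeP (m : nat) : (m < next_prime m)%N /\ prime (next_prime m).
Proof. by rewrite /next_prime; case: ex_minnP => p /andP[]. Qed.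

Lemma next_prime_min (m p : nat) :
  (m < p)%N -> prime p -> (next_prime m <= p)%N.
Proof.
by move=> mp pp; rewrite /next_prime; case: ex_minnP => q _; apply; rewrite mp.
Qed.

Lemma prime_nth_prime (i : nat) : prime (nth_prime i.+1).
Proof. exact: (next_primeP _).2. Qed.

Lemma primorialE (k : nat) :
  primorial k = (\prod_(p <- [seq nth_prime j | j <- index_iota 1 k.+1]) p)%N.
Proof. by rewrite big_map. Qed.

Lemma primorial_gt0 (k : nat) : (0 < primorial k)%N.
Proof.
rewrite /primorial big_add1; apply: prodn_gt0 => i.
exact: prime_gt0 (prime_nth_prime i).
Qed.

(** Both lists are strictly increasing, so equal membership suffices; a prime dividing the product
    divides, hence equals, some member of [s]. *)
Lemma primes_prod (s : seq nat) :
  sorted ltn s -> all prime s -> primes (\prod_(p <- s) p)%N = s.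
Proof.
move=> ss ps; apply: (irr_sorted_eq ltn_trans ltnn (sorted_primes _) ss) => q.
rewrite mem_primes; apply/and3P/idP => [[pq _]|qs].
  rewrite Euclid_dvd_prod // big_has => /hasP[p sp qp].
  by move: qp; rewrite dvdn_prime2 ?(allP ps _ sp) // => /eqP->.
have pq := allP ps _ qs; split => //.
  by rewrite big_seq; apply: prodn_cond_gt0 => p /(allP ps)/prime_gt0.
by rewrite Euclid_dvd_prod // big_has; apply/hasP; exists q.
Qed.

Lemma primes_primorial (k : nat) :
  primes (primorial k) = [seq nth_prime j | j <- index_iota 1 k.+1].
Proof.
rewrite primorialE primes_prod //.
  apply: (@homo_sorted _ _ nth_prime ltn ltn); last exact: iota_ltn_sorted.
  by apply: (homo_ltn ltn_trans) => i; exact: (next_primeP _).1.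
(* The range starts at 1, which excludes the non-prime seed [nth_prime 0]. *)
by apply/allP => _ /mapP[[|j] + ->]; rewrite ?mem_index_iota // prime_nth_prime.
Qed.

(** Induction: each prime divisor exceeds the previous one, hence the previous [nth_prime], and
    [next_prime] is minimal. The shift arises because [nth] counts from 0. *)
Lemma nth_prime_le_primes (n i : nat) :
  (i < omega n)%N -> (nth_prime i.+1 <= nth 0 (primes n) i)%N.
Proof.
rewrite /omega; elim: i => [|i IH] hi.
  have := mem_nth 0%N hi; rewrite mem_primes => /and3P[pp _ _].
  by apply: next_prime_min => //; exact: prime_gt0.
have := mem_nth 0%N hi; rewrite mem_primes => /and3P[pp _ _].
apply: next_prime_min => //; apply: (leq_ltn_trans (IH (ltnW hi))).
by apply: (sorted_ltn_nth ltn_trans 0%N (sorted_primes n)); rewrite ?inE ?(ltnW hi).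
Qed.

Lemma primorial_omega_le (n : nat) : (0 < n)%N -> (primorial (omega n) <= n)%N.
Proof.
move=> n0; rewrite [leqRHS](prod_primesE n n0) (big_nth 0%N) /primorial big_add1 /=.
rewrite big_nat [leqRHS]big_nat.
(* Factor by factor: the prime of the primorial is at most [p], and [p] at most its full power in
   [n]. *)
elim/big_ind2: _ => // [a b c d|i /andP[_ hi]]; first exact: leq_mul.
have := mem_nth 0%N hi; rewrite mem_primes => /and3P[pp _ _].
apply: (leq_trans (nth_prime_le_primes _ _ hi)).
by rewrite leq_pmulr // expn_gt0 prime_gt0.
Qed.

Lemma f_ratio_le_primorial (R : realType) (n : nat) : (0 < n)%N ->
  f_ratio R n <= f_ratio R (primorial (omega n)).
Proof.
move=> n0; rewrite !f_ratioE ?primorial_gt0 // primes_primorial big_map.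
rewrite (big_nth 0%N) big_add1 succnK.
rewrite big_nat [leRHS]big_nat; apply: ler_prod => i /andP[_ hi].
have := nth_prime_le_primes _ _ hi.
move: (prime_gt1 (prime_nth_prime i)).
move: (nth _ _ _) (nth_prime i.+1) => p [|[|q]] // _ qp.
case: p qp => [|[|p]] // qp.
rewrite divr_ge0 ?ler0n //= ler_pdivrMr ?ltr0n // mulrAC ler_pdivlMr ?ltr0n //.
(* The map x / (x - 1) decreases: after cross-multiplying and cancelling the common product,
   [q.+1 <= p.+1] remains. *)
by rewrite -!natrM ler_nat mulSn [leqRHS]mulSn mulnC leq_add2r.
Qed.

Theorem corollary1p5 (R : realType) (n : nat) :
  (2 <= n)%N ->
  f_ratio R (primorial (omega n))
    - expR (euler_gamma R) * ln (ln (primorial (omega n))%:R) <= 0 ->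
  s_ratio R n < expR (euler_gamma R) * ln (ln n%:R).
Proof.
move=> n2; rewrite subr_le0 => hN; have n0 : (0 < n)%N := ltnW n2.
apply: (lt_le_trans (s_ratio_lt_f_ratio R n n2)).
apply: (le_trans (f_ratio_le_primorial R n n0)); apply: (le_trans hN).
(* The outer [ln] is monotone on positive arguments, so [ln] of the primorial must be positive. A
   primorial equal to 1 would leave [n] without prime divisors. *)
have N2 : (1 < primorial (omega n))%N.
  rewrite ltn_neqAle primorial_gt0 andbT; apply/eqP => N1.
  have := primes_primorial (omega n); rewrite -N1 => /(congr1 size).
  rewrite size_map size_iota subn1 => /esym/eqP; rewrite size_eq0 primes_eq0.
  by rewrite ltnNge n2.
rewrite ler_pM2l ?expR_gt0 // ler_ln ?posrE ?ln_gt0 ?ltr1n //.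
by rewrite ler_ln ?posrE ?ltr0n ?primorial_gt0 // ler_nat primorial_omega_le.
Qed.
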